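(* Let $(X,\tau,h)$ be a premetric space such that $(X,\tau)$ is Hausdorff and $h$ satisfies (P1), (P2) and (P3). Let $S:X\rightrightarrows X$ be a set-valued map. Suppose $M:=\{x_i\}_{i=1}^{\infty}$ is an $h$-contractive $S$-orbit that satisfies property $(\bar{\star})$. Then there exists an accumulation point $\bar{x}$ of $M$ such that $S(\bar{x})\subseteq\{\bar{x}\}$.
   Context: A premetric space $(X,\tau,h)$ is a first countable topological space $(X,\tau)$ with a function $h:X\times X\to[0,\infty)$ satisfying (P1): $h(x,y)=0\Leftrightarrow x=y$. (No symmetry or triangle inequality is assumed.) Further properties: (P2) if $h(x,x_n)\to 0$, then $x_n\to x$; (P3) if $x_n\to x$, then $h(x_{n+1},x_n)\to 0$. A set-valued map $S:X\rightrightarrows X$ assigns to each $x\in X$ a (possibly empty) subset $S(x)\subseteq X$. An infinite $S$-orbit is a sequence $\{x_i\}_{i=1}^\infty$ with $x_{i+1}\in S(x_i)$ for all $i\ge1$. For nonempty $C\subseteq X$, $h_C(x):=\sup_{y\in C}h(y,x)$. An infinite $S$-orbit $\{x_i\}_{i=1}^\infty$ is $h$-contractive if it has a convergent subsequence $\{x_{i_k}\}_{k=1}^\infty$ with $h_{S(x_{i_k})}(x_{i_k})\to 0$ as $k\to\infty$. An infinite $S$-orbit $\{x_i\}_{i=1}^\infty$ satisfies property $(\bar\star)$ if for each subsequence $\{x_{i_k}\}_{k=1}^\infty$ converging to a point $x$, and each $y\in S(x)$ with $y\ne x$, one has $y\in S(x_{i_k})$ for all $k\in\mathbb{N}$. An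 accumulation point of the orbit means an accumulation point of the sequence $\{x_i\}$, i.e. (by first countability) the limit of some convergent subsequence. *)

(* Defs.v *)
From mathcomp Require Import all_boot all_order all_algebra.
From mathcomp Require Import all_classical all_reals all_analysis.
Import numFieldNormedType.Exports.

Set Implicit Arguments.
Unset Strict Implicit.
Unset Printing Implicit Defensive.

Import Order.TTheory GRing.Theory Num.Theory.

Local Open Scope classical_set_scope.
Local Open Scope ring_scope.

Definition first_countable (X : topologicalType) : Prop :=
  forall x : X, exists2 B : set (set X), countable B &
    B `<=` nbhs x /\ forall U, nbhs x U -> exists2 V, B V & V `<=` U.

Definition P1 (R : realType) (X : Type) (h : X -> X -> R) : Prop :=
  forall x y, h x y = 0 <-> x = y.

(* The topology is not assumed to be induced by [h]. *)
Definition premetric (R : realType) (X : topologicalType) (h : X -> X -> R) :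
    Prop :=
  [/\ first_countable X, (forall x y, 0 <= h x y) & P1 h].

Definition P2 (R : realType) (X : topologicalType) (h : X -> X -> R) : Prop :=
  forall (x : X) (u : nat -> X),
    (fun n => h x (u n)) @ \oo --> (0 : R) -> u @ \oo --> x.

Definition P3 (R : realType) (X : topologicalType) (h : X -> X -> R) : Prop :=
  forall (x : X) (u : nat -> X),
    u @ \oo --> x -> (fun n => h (u n.+1) (u n)) @ \oo --> (0 : R).

(* The supremum may be infinite, hence the extended reals. Only relevant for
   nonempty [C]: on the empty set the value is -oo. *)
Definition hsup (R : realType) (X : Type) (h : X -> X -> R)
    (C : set X) (x : X) : \bar R :=
  ereal_sup [set (h y x)%:E | y in C].

(* A set-valued map from X to X is a function [S : X -> set X]; sequences are
   indexed from 0, and a subsequence of [u] is [u \o f] with [f] strictly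
   increasing. *)
Definition infinite_orbit (X : Type) (S : X -> set X) (u : nat -> X) : Prop :=
  forall n, S (u n) (u n.+1).

Definition h_contractive (R : realType) (X : topologicalType)
    (h : X -> X -> R) (S : X -> set X) (u : nat -> X) : Prop :=
  exists2 f : nat -> nat, increasing_seq f &
    (exists x : X, u \o f @ \oo --> x) /\
    (fun k => hsup h (S (u (f k))) (u (f k))) @ \oo --> (0%:E : \bar R).

Definition star_bar (X : topologicalType) (S : X -> set X) (u : nat -> X) :
    Prop :=
  forall (f : nat -> nat) (x : X), increasing_seq f -> u \o f @ \oo --> x ->
  forall y, S x y -> y <> x -> forall k, S (u (f k)) y.

(* In a first countable space this is the same as [cluster (u @ \oo) x]. *)
Definition accumulation_point (X : topologicalType) (u : nat -> X) (x : X) :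
    Prop :=
  exists2 f : nat -> nat, increasing_seq f & u \o f @ \oo --> x.

(* Main.v *)
Require Import Defs.
From mathcomp Require Import all_boot all_order all_algebra.
From mathcomp Require Import all_classical all_reals all_analysis.

Local Open Scope classical_set_scope.

(** The limit x of the subsequence x_{i_k} given by h-contractivity works: by
    property (star-bar), any y in S x distinct from x lies in every
    S x_{i_k}, so h(y, x_{i_k}) is at most h_{S x_{i_k}}(x_{i_k}) and tends to 0.
    By (P2) the subsequence then also converges to y, against uniqueness of
    limits. *)

Theorem theorem5p8 (R : realType) (X : topologicalType) (h : X -> X -> R)
    (hX : premetric h) (hT2 : hausdorff_space X) (hP2 : P2 h) (hP3 : P3 h)
    (S : X -> set X) (u : nat -> X)
    (hu : infinite_orbit S u) (hcontr : h_contractive h S u)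
    (hstar : star_bar S u) :
  exists xbar : X, accumulation_point u xbar /\ S xbar `<=` [set xbar].
Proof.
case: hX => _ h_ge0 _.
case: hcontr => f incf [[x ufx] hsup0].
exists x; split; first by exists f.
move=> y Sxy /=; apply: contrapT => yx.
suff ufy : (u \o f)%FUN @ \oo --> y by apply/yx/(cvg_unique hT2 ufy ufx).
apply: hP2.
(* [hsup] takes values in [\bar R], so the squeeze is carried out there; [fine_cvgP] brings the
   limit back to [R], where [fine] cancels [%:E] by computation. *)
suff /fine_cvgP[] : (fun k => (h y (u (f k)))%:E) @ \oo --> (0%:E : \bar R)%E by [].
apply: squeeze_cvge (cvg_cst _) hsup0.
(* Both bounds hold for every [k], not only eventually: [y] lies in each [S (u (f k))], so the
   supremum there is over a nonempty set and its default value [-oo] never occurs. *)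
apply: nearW => k; rewrite lee_fin h_ge0 /=.
apply: ereal_sup_ubound; exists y => //.
exact: hstar incf ufx _ Sxy yx k.
Qed.
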